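(* The cut rule is admissible in $\mathbf{G}(\mathsf{FBInqBQ})$: for all finite multisets $\Gamma,\Delta,\Pi,\Sigma$ of labelled formulas and every labelled formula $X:\varphi$, if $\Gamma\Rightarrow\Delta,X:\varphi$ and $X:\varphi,\Pi\Rightarrow\Sigma$ are both derivable in $\mathbf{G}(\mathsf{FBInqBQ})$, then $\Gamma,\Pi\Rightarrow\Delta,\Sigma$ is derivable in $\mathbf{G}(\mathsf{FBInqBQ})$.
   Context: Language: countably infinite set of variables, countably infinite set of predicate symbols with arities (no identity, constants, function symbols). Formulas: $\varphi ::= P(x_1,\dots,x_m)\mid \bot\mid \varphi\to\varphi\mid\varphi\wedge\varphi\mid \varphi\veebar\varphi\mid \forall x\varphi\mid \bar\exists x\varphi$ ($\veebar$ inquisitive disjunction, $\bar\exists$ inquisitive existential). $\varphi[z/x]$ is capture-avoiding substitution. Calculus $\mathbf{G}(\mathsf{FBInqBQ})$: a label is a nonempty finite subset of $\omega$; a labelled formula is $X:\varphi$ with $X$ a label; a sequent $\Gamma\Rightarrow\Delta$ is a pair of finite multisets of labelled formulas. $X,Y$ range over labels. Initial sequents: $(\mathtt{id})$ $X:P(\bar x),\Gamma\Rightarrow\Delta,Y:P(\bar x)$ whenever $X\supseteq Y$; $(\bot\Rightarrow)$ $X:\bot,\Gamma\Rightarrow\Delta$. Rules (premises / conclusion): $(\Rightarrow\mathtt{at})$: $\Gamma\Rightarrow\Delta,\{k\}:P(\bar x)$ for every $k\in X$ / $\Gamma\Rightarrow\Delta,X:P(\bar x)$. $(\Rightarrow\wedge)$: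 $\Gamma\Rightarrow\Delta,X:\varphi$ and $\Gamma\Rightarrow\Delta,X:\psi$ / $\Gamma\Rightarrow\Delta,X:\varphi\wedge\psi$. $(\wedge\Rightarrow)$: $X:\varphi,X:\psi,\Gamma\Rightarrow\Delta$ / $X:\varphi\wedge\psi,\Gamma\Rightarrow\Delta$. $(\Rightarrow\veebar)$: $\Gamma\Rightarrow\Delta,X:\varphi,X:\psi$ / $\Gamma\Rightarrow\Delta,X:\varphi\veebar\psi$. $(\veebar\Rightarrow)$: $X:\varphi,\Gamma\Rightarrow\Delta$ and $X:\psi,\Gamma\Rightarrow\Delta$ / $X:\varphi\veebar\psi,\Gamma\Rightarrow\Delta$. $(\Rightarrow\to)$: $Y:\varphi,\Gamma\Rightarrow\Delta,Y:\psi$ for every label $Y\subseteq X$ / $\Gamma\Rightarrow\Delta,X:\varphi\to\psi$. $(\to\Rightarrow)$, for a label $Y\subseteq X$: $X:\varphi\to\psi,\Gamma\Rightarrow\Delta,Y:\varphi$ and $Y:\psi,X:\varphi\to\psi,\Gamma\Rightarrow\Delta$ / $X:\varphi\to\psi,\Gamma\Rightarrow\Delta$. $(\Rightarrow\forall)$: $\Gamma\Rightarrow\Delta,X:\varphi[z/x]$ / $\Gamma\Rightarrow\Delta,X:\forall x\varphi$, with $z$ not occurring in the conclusion. $(\forall\Rightarrow)$: $X:\varphi[y/x],X:\forall x\varphi,\Gamma\Rightarrow\Delta$ / $X:\forall x\varphi,\Gamma\Rightarrow\Delta$ ($y$ arbitrary). $(\Rightarrow\bar\exists)$: $\Gamma\Rightarrow\Delta,X:\bar\exists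 x\varphi,X:\varphi[y/x]$ / $\Gamma\Rightarrow\Delta,X:\bar\exists x\varphi$ ($y$ arbitrary). $(\bar\exists\Rightarrow)$: $X:\varphi[z/x],\Gamma\Rightarrow\Delta$ / $X:\bar\exists x\varphi,\Gamma\Rightarrow\Delta$, with $z$ not occurring in the conclusion. A derivation is a finite tree of sequents built from initial sequents by these rules; a sequent is derivable if it is the root of a derivation. *)

(* Defs.v *)
From HB Require Import structures.
From mathcomp Require Import all_boot finmap multiset.

Set Implicit Arguments.
Unset Strict Implicit.
Unset Printing Implicit Defensive.

(* Individual variables and predicate symbols are both indexed by nat; the
   function ar assigns an arity to every predicate symbol. *)

Section Formulas.

Variable ar : nat -> nat.

Inductive formula : Type :=
  | Atom (P : nat) (xs : (ar P).-tuple nat)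
  | Bot
  | Imp (phi psi : formula)
  | And (phi psi : formula)
  | IOr (phi psi : formula)           (* inquisitive disjunction *)
  | All (x : nat) (phi : formula)
  | IEx (x : nat) (phi : formula).    (* inquisitive existential *)

(* Multisets of formulas require a choiceType, which is obtained by encoding
   formulas as generic trees. *)
Local Notation leaf := (nat + {P : nat & (ar P).-tuple nat})%type.

Fixpoint formula_encode (phi : formula) : GenTree.tree leaf :=
  match phi with
  | Atom P xs => GenTree.Leaf (inr (Tagged (fun P => (ar P).-tuple nat) xs))
  | Bot => GenTree.Node 0 [::]
  | Imp a b => GenTree.Node 1 [:: formula_encode a; formula_encode b]
  | And a b => GenTree.Node 2 [:: formula_encode a; formula_encode b]
  | IOr a b => GenTree.Node 3 [:: formula_encode a; formula_encode b]
  | All x a => GenTree.Node 4 [:: GenTree.Leaf (inl x); formula_encode a]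
  | IEx x a => GenTree.Node 5 [:: GenTree.Leaf (inl x); formula_encode a]
  end.

Fixpoint formula_decode (t : GenTree.tree leaf) : formula :=
  match t with
  | GenTree.Leaf (inr u) => Atom (tagged u)
  | GenTree.Node 1 [:: a; b] => Imp (formula_decode a) (formula_decode b)
  | GenTree.Node 2 [:: a; b] => And (formula_decode a) (formula_decode b)
  | GenTree.Node 3 [:: a; b] => IOr (formula_decode a) (formula_decode b)
  | GenTree.Node 4 [:: GenTree.Leaf (inl x); a] => All x (formula_decode a)
  | GenTree.Node 5 [:: GenTree.Leaf (inl x); a] => IEx x (formula_decode a)
  | _ => Bot
  end.

Lemma formula_encodeK : cancel formula_encode formula_decode.
Proof. by elim=> //= [a -> b ->|a -> b ->|a -> b ->|x a ->|x a ->]. Qed.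

HB.instance Definition _ := Countable.copy formula (can_type formula_encodeK).

Fixpoint free_vars (phi : formula) : seq nat :=
  match phi with
  | Atom _ xs => xs
  | Bot => [::]
  | Imp a b | And a b | IOr a b => free_vars a ++ free_vars b
  | All x a | IEx x a => [seq v <- free_vars a | v != x]
  end.

(* All variables of a formula: free, bound, or attached to a quantifier. *)
Fixpoint vars (phi : formula) : seq nat :=
  match phi with
  | Atom _ xs => xs
  | Bot => [::]
  | Imp a b | And a b | IOr a b => vars a ++ vars b
  | All x a | IEx x a => x :: vars a
  end.

(* avoid x s is x if x is not in s, and otherwise a variable not in s. *)
Definition avoid (x : nat) (s : seq nat) : nat :=
  if x \in s then (\max_(v <- s) v).+1 else x.

(* Simultaneous capture-avoiding substitution of the variables sigma v for
   the free occurrences of v.  A bound variable is renamed exactly when it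
   would capture a variable substituted into its scope. *)
Fixpoint subst (sigma : nat -> nat) (phi : formula) : formula :=
  match phi with
  | Atom _ xs => Atom (map_tuple sigma xs)
  | Bot => Bot
  | Imp a b => Imp (subst sigma a) (subst sigma b)
  | And a b => And (subst sigma a) (subst sigma b)
  | IOr a b => IOr (subst sigma a) (subst sigma b)
  | All x a =>
      let x' := avoid x [seq sigma v | v <- free_vars a & v != x] in
      All x' (subst [eta sigma with x |-> x'] a)
  | IEx x a =>
      let x' := avoid x [seq sigma v | v <- free_vars a & v != x] in
      IEx x' (subst [eta sigma with x |-> x'] a)
  end.

(* phi[z/x] *)
Definition subst1 (phi : formula) (z x : nat) : formula :=
  subst [eta id with x |-> z] phi.

End Formulas.

Arguments Bot {ar}.

Definition label : Type := {X : {fset nat} | X != fset0}.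

Lemma fset1_neq0 (k : nat) : [fset k]%fset != fset0.
Proof. by apply/fset0Pn; exists k; rewrite in_fset1. Qed.

Definition label1 (k : nat) : label := exist _ [fset k]%fset (fset1_neq0 k).

Definition sublabel (Y X : label) : bool := (val Y `<=` val X)%fset.

Definition lformula (ar : nat -> nat) : Type := (label * formula ar)%type.

Local Open Scope mset_scope.

Definition cedent (ar : nat -> nat) : Type := {mset lformula ar}.

Definition not_occurring (ar : nat -> nat) (z : nat) (G : cedent ar) : Prop :=
  forall l : lformula ar, l \in G -> z \notin vars l.2.

(* derivable G D: the sequent G => D is the root of a derivation.
   The name of a rule ends in L (R) if its principal formula is on the left
   (right). *)
Inductive derivable (ar : nat -> nat) : cedent ar -> cedent ar -> Prop :=
  | d_id (X Y : label) (P : nat) (xs : (ar P).-tuple nat) (G D : cedent ar) :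
      sublabel Y X ->
      derivable ((X, Atom xs) +` G) ((Y, Atom xs) +` D)
  | d_botL (X : label) (G D : cedent ar) :
      derivable ((X, Bot) +` G) D
  | d_atR (X : label) (P : nat) (xs : (ar P).-tuple nat) (G D : cedent ar) :
      (forall k : nat, k \in val X ->
         derivable G ((label1 k, Atom xs) +` D)) ->
      derivable G ((X, Atom xs) +` D)
  | d_andR (X : label) (phi psi : formula ar) (G D : cedent ar) :
      derivable G ((X, phi) +` D) ->
      derivable G ((X, psi) +` D) ->
      derivable G ((X, And phi psi) +` D)
  | d_andL (X : label) (phi psi : formula ar) (G D : cedent ar) :
      derivable ((X, phi) +` ((X, psi) +` G)) D ->
      derivable ((X, And phi psi) +` G) D
  | d_iorR (X : label) (phi psi : formula ar) (G D : cedent ar) :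
      derivable G ((X, phi) +` ((X, psi) +` D)) ->
      derivable G ((X, IOr phi psi) +` D)
  | d_iorL (X : label) (phi psi : formula ar) (G D : cedent ar) :
      derivable ((X, phi) +` G) D ->
      derivable ((X, psi) +` G) D ->
      derivable ((X, IOr phi psi) +` G) D
  | d_impR (X : label) (phi psi : formula ar) (G D : cedent ar) :
      (forall Y : label, sublabel Y X ->
         derivable ((Y, phi) +` G) ((Y, psi) +` D)) ->
      derivable G ((X, Imp phi psi) +` D)
  | d_impL (X Y : label) (phi psi : formula ar) (G D : cedent ar) :
      sublabel Y X ->
      derivable ((X, Imp phi psi) +` G) ((Y, phi) +` D) ->
      derivable ((Y, psi) +` ((X, Imp phi psi) +` G)) D ->
      derivable ((X, Imp phi psi) +` G) D
  | d_allR (X : label) (x z : nat) (phi : formula ar) (G D : cedent ar) :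
      not_occurring z G ->
      not_occurring z ((X, All x phi) +` D) ->
      derivable G ((X, subst1 phi z x) +` D) ->
      derivable G ((X, All x phi) +` D)
  | d_allL (X : label) (x y : nat) (phi : formula ar) (G D : cedent ar) :
      derivable ((X, subst1 phi y x) +` ((X, All x phi) +` G)) D ->
      derivable ((X, All x phi) +` G) D
  | d_iexR (X : label) (x y : nat) (phi : formula ar) (G D : cedent ar) :
      derivable G ((X, subst1 phi y x) +` ((X, IEx x phi) +` D)) ->
      derivable G ((X, IEx x phi) +` D)
  | d_iexL (X : label) (x z : nat) (phi : formula ar) (G D : cedent ar) :
      not_occurring z ((X, IEx x phi) +` G) ->
      not_occurring z D ->
      derivable ((X, subst1 phi z x) +` G) D ->
      derivable ((X, IEx x phi) +` G) D.

(* Main.v *)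
(** The proof is semantic.  Read a label as an information state and let worlds
    and individuals be natural numbers.  Every rule is sound for the resulting
    support semantics.  Conversely, the calculus has no cut rule, so applying
    its rules backwards along a fair schedule to an underivable sequent, always
    keeping an underivable premise, yields in the limit a Hintikka set and hence
    a countermodel of that sequent.  A countermodel of the conclusion of a cut
    either supports the cut formula, and refutes the right premise, or does not,
    and refutes the left one. *)

From Stdlib Require Import Classical ClassicalEpsilon.
Require Import Defs.
From mathcomp Require Import all_boot finmap multiset.

Set Implicit Arguments.
Unset Strict Implicit.
Unset Printing Implicit Defensive.

Local Open Scope mset_scope.

(** * Variables, substitution and formula size *)

Lemma avoid_notin (x : nat) (s : seq nat) : avoid x s \notin s.
Proof.
rewrite /avoid; case: ifP => [_|/negbT//].
by apply/negP => /(@leq_bigmax_seq _ s xpredT id)/(_ isT); rewrite ltnn.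
Qed.

Lemma sub_free_vars (ar : nat -> nat) (phi : formula ar) :
  {subset free_vars phi <= vars phi}.
Proof.
elim: phi => [P xs||a IHa b IHb|a IHa b IHb|a IHa b IHb|x a IHa|x a IHa] v //=.
- by rewrite !mem_cat => /orP[/IHa|/IHb] ->; rewrite ?orbT.
- by rewrite !mem_cat => /orP[/IHa|/IHb] ->; rewrite ?orbT.
- by rewrite !mem_cat => /orP[/IHa|/IHb] ->; rewrite ?orbT.
- by rewrite mem_filter inE => /andP[_ /IHa ->]; rewrite orbT.
- by rewrite mem_filter inE => /andP[_ /IHa ->]; rewrite orbT.
Qed.

(** Measure for the truth lemma: the instance [subst1 a y x] is not a subformula of [All x a] or
    [IEx x a], but it is smaller, since substitution preserves size. *)
Fixpoint fsize (ar : nat -> nat) (phi : formula ar) : nat :=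
  match phi with
  | Atom _ _ | Bot => 0
  | Imp a b | And a b | IOr a b => (fsize a + fsize b).+1
  | All _ a | IEx _ a => (fsize a).+1
  end.

Lemma fsize_subst (ar : nat -> nat) (sigma : nat -> nat) (phi : formula ar) :
  fsize (subst sigma phi) = fsize phi.
Proof.
elim: phi sigma => [P xs||a IHa b IHb|a IHa b IHb|a IHa b IHb|x a IHa|x a IHa]
  sigma //=; by rewrite ?IHa ?IHb.
Qed.

(** * Support semantics and soundness *)

Section Support.

Variables (ar : nat -> nat) (V : nat -> forall P : nat, (ar P).-tuple nat -> Prop).

(* Worlds and individuals are natural numbers, and a label is itself an
   information state, so no separate interpretation of labels is needed. *)
Fixpoint supp (g : nat -> nat) (phi : formula ar) (X : label) : Prop :=
  match phi with
  | Atom P xs => forall k, k \in val X -> V k (map_tuple g xs)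
  | Bot => False
  | Imp a b => forall Y, sublabel Y X -> supp g a Y -> supp g b Y
  | And a b => supp g a X /\ supp g b X
  | IOr a b => supp g a X \/ supp g b X
  | All x a => forall d, supp [eta g with x |-> d] a X
  | IEx x a => exists d, supp [eta g with x |-> d] a X
  end.

Lemma supp_eq (phi : formula ar) (g h : nat -> nat) (X : label) :
  {in free_vars phi, g =1 h} -> supp g phi X <-> supp h phi X.
Proof.
have upd x a (f f' : nat -> nat) d : {in [seq v <- free_vars a | v != x], f =1 f'} ->
    {in free_vars (a : formula ar), [eta f with x |-> d] =1 [eta f' with x |-> d]}.
  move=> E v va /=; case: eqP => // /eqP vx; apply: E; by rewrite mem_filter vx.
elim: phi g h X => [P xs||a IHa b IHb|a IHa b IHb|a IHa b IHb|x a IHa|x a IHa]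
  g h X /= E //.
- by rewrite (_ : map_tuple g xs = map_tuple h xs) //; apply/val_inj/eq_in_map.
- have Ha Y : supp g a Y <-> supp h a Y.
    by apply: IHa => v va; apply: E; rewrite mem_cat va.
  have Hb Y : supp g b Y <-> supp h b Y.
    by apply: IHb => v vb; apply: E; rewrite mem_cat vb orbT.
  by split=> H Y YX /Ha Y1; apply/Hb/H.
- by rewrite (IHa g h) ?(IHb g h) // => v va; apply: E; rewrite mem_cat va ?orbT.
- by rewrite (IHa g h) ?(IHb g h) // => v va; apply: E; rewrite mem_cat va ?orbT.
- by split=> H d; apply/(IHa _ _ _ (upd x a _ _ d E)).
- by split=> -[d H]; exists d; apply/(IHa _ _ _ (upd x a _ _ d E)).
Qed.

Lemma supp_subst (phi : formula ar) (sigma g : nat -> nat) (X : label) :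
  supp g (subst sigma phi) X <-> supp (g \o sigma) phi X.
Proof.
elim: phi sigma g X => [P xs||a IHa b IHb|a IHa b IHb|a IHa b IHb|x a IHa|x a IHa]
  s g X //=; try by rewrite IHa IHb.
- rewrite (_ : map_tuple g (map_tuple s xs) = map_tuple (g \o s) xs) //.
  by apply: val_inj; rewrite /= map_comp.
- by split=> H Y YX /IHa Ya; apply/IHb/H.
all: set x' := avoid _ _.
(* [avoid] places [x'] outside the images of the other free variables of [a], so assigning [d] to
   [x'] disturbs none of their values. *)
all: have upd d : {in free_vars a, [eta g with x' |-> d] \o [eta s with x |-> x']
                       =1 [eta g \o s with x |-> d]}
  by move=> v va /=; case: (eqVneq v x) => [_|vx]; rewrite ?eqxx //;
     case: eqP => // E; have := avoid_notin x [seq s v | v <- free_vars a & v != x];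
     rewrite -/x' -E map_f // mem_filter vx.
- by split=> H d; have := H d; rewrite IHa (supp_eq _ (upd d)).
- by split=> -[d H]; exists d; move: H; rewrite IHa (supp_eq _ (upd d)).
Qed.

Lemma supp_subst1 (phi : formula ar) (g : nat -> nat) (z x : nat) (X : label) :
  supp g (subst1 phi z x) X <-> supp [eta g with x |-> g z] phi X.
Proof.
rewrite supp_subst; apply: supp_eq => v _ /=.
by case: eqP.
Qed.

Lemma supp_fresh (phi : formula ar) (g : nat -> nat) (z d : nat) (X : label) :
  z \notin vars phi -> supp [eta g with z |-> d] phi X <-> supp g phi X.
Proof.
move=> zphi; apply: supp_eq => v /sub_free_vars vphi /=.
by case: eqP => // E; rewrite -E vphi in zphi.
Qed.

(** Semantic content of the eigenvariable condition: a fresh [z] can be given any individual [d], so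
    the single premise for [z] covers every value of the quantified variable. *)
Lemma supp_fresh_subst1 (phi : formula ar) (g : nat -> nat) (x z d : nat)
    (X : label) :
  z \notin vars phi ->
  supp [eta g with z |-> d] (subst1 phi z x) X <-> supp [eta g with x |-> d] phi X.
Proof.
move=> zphi; rewrite supp_subst1; apply: supp_eq => v /sub_free_vars vphi /=.
rewrite eqxx; case: (v == x) => //; case: eqP => // E; by rewrite -E vphi in zphi.
Qed.

Definition all_supp (g : nat -> nat) (G : cedent ar) : Prop :=
  forall l, l \in G -> supp g l.2 l.1.

Definition none_supp (g : nat -> nat) (D : cedent ar) : Prop :=
  forall l, l \in D -> ~ supp g l.2 l.1.

Lemma all_supp1D (g : nat -> nat) (X : label) (phi : formula ar) (G : cedent ar) :
  all_supp g ((X, phi) +` G) <-> supp g phi X /\ all_supp g G.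
Proof.
split=> [H|[H HG] l]; last by rewrite in_mset1D => /predU1P[->|/HG].
by split=> [|l lG]; [apply: (H (X, phi)) | apply: H]; rewrite in_mset1D ?eqxx ?lG ?orbT.
Qed.

Lemma none_supp1D (g : nat -> nat) (X : label) (phi : formula ar) (D : cedent ar) :
  none_supp g ((X, phi) +` D) <-> ~ supp g phi X /\ none_supp g D.
Proof.
split=> [H|[H HD] l]; last by rewrite in_mset1D => /predU1P[->|/HD].
by split=> [|l lD]; [apply: (H (X, phi)) | apply: H]; rewrite in_mset1D ?eqxx ?lD ?orbT.
Qed.

Lemma all_supp_fresh (g : nat -> nat) (z d : nat) (G : cedent ar) :
  not_occurring z G -> all_supp g G -> all_supp [eta g with z |-> d] G.
Proof. by move=> zG HG l lG; apply/supp_fresh; [apply: zG | apply: HG]. Qed.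

Lemma none_supp_fresh (g : nat -> nat) (z d : nat) (D : cedent ar) :
  not_occurring z D -> none_supp g D -> none_supp [eta g with z |-> d] D.
Proof. by move=> zD HD l lD /supp_fresh; move=> /(_ (zD l lD)); apply: HD. Qed.

Lemma not_occurring1D (z : nat) (X : label) (phi : formula ar) (G : cedent ar) :
  not_occurring z ((X, phi) +` G) -> z \notin vars phi /\ not_occurring z G.
Proof.
move=> H; split=> [|l lG]; first by apply: (H (X, phi)); rewrite in_mset1D eqxx.
by apply: H; rewrite in_mset1D lG orbT.
Qed.

(** The succedent is read disjunctively: no assignment supports all of [G] and nothing in [D]. The
    assignment stays general in the induction because the eigenvariable rules change it. *)
Lemma soundness (G D : cedent ar) : derivable G D ->
  forall g, all_supp g G -> none_supp g D -> False.
Proof.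
elim=> {G D}
  [X Y P xs G D YX|X G D|X P xs G D _ IH|X a b G D _ IH1 _ IH2|X a b G D _ IH
  |X a b G D _ IH|X a b G D _ IH1 _ IH2|X a b G D _ IH|X Y a b G D YX _ IH1 _ IH2
  |X x z a G D zG zD _ IH|X x y a G D _ IH|X x y a G D _ IH|X x z a G D zG zD _ IH] g.
- move=> /all_supp1D[HX _] /none_supp1D[+ _]; apply=> k kY.
  by apply: HX; apply: (fsubsetP YX).
- by move=> /all_supp1D[].
(* Atoms are supported world by world, so a failure at [k] already refutes the premise for the
   singleton label of [k]. *)
- move=> HG /none_supp1D[+ HD]; apply=> k kX; apply: NNPP => nV.
  apply: (IH k kX g HG); apply/none_supp1D; split=> // H.
  by apply/nV/H; rewrite /= in_fset1.
- move=> HG /none_supp1D[nab HD]; apply: (IH1 g HG); apply/none_supp1D; split=> // Ha.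
  by apply: (IH2 g HG); apply/none_supp1D; split=> // Hb; apply: nab.
- by move=> /all_supp1D[[Ha Hb] HG]; apply: IH; do 2?[apply/all_supp1D; split].
- move=> HG /none_supp1D[nab HD]; apply: (IH g HG).
  by apply/none_supp1D; split; [|apply/none_supp1D; split] => // H; apply: nab; [left|right].
- by move=> /all_supp1D[[H|H] HG]; [apply: IH1 | apply: IH2]; apply/all_supp1D.
- move=> HG /none_supp1D[+ HD]; apply=> Y YX Ha; apply: NNPP => nb.
  by apply: (IH Y YX g); [apply/all_supp1D | apply/none_supp1D].
- move=> Hall HD; have /all_supp1D[H HG] := Hall.
  apply: (IH1 g) => //; apply/none_supp1D; split=> // Ha.
  by apply: (IH2 g) => //; apply/all_supp1D; split=> //; apply: H.
- have [+ zD'] := not_occurring1D zD; rewrite /= inE negb_or => /andP[_ za].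
  move=> HG /none_supp1D[+ HD]; apply=> d; apply: NNPP => nH.
  apply: (IH [eta g with z |-> d]); first exact: all_supp_fresh.
  by apply/none_supp1D; split; [rewrite supp_fresh_subst1 | apply: none_supp_fresh].
- move=> Hall; apply: IH; apply/all_supp1D; split=> //; apply/supp_subst1.
  by have /all_supp1D[H _] := Hall; apply: H.
- move=> HG Hnone; apply: (IH g HG); apply/none_supp1D; split=> // /supp_subst1 H.
  by have /none_supp1D[+ _] := Hnone; apply; exists (g y).
- have [+ zG'] := not_occurring1D zG; rewrite /= inE negb_or => /andP[_ za].
  move=> /all_supp1D[[d Hd] HG] HD.
  apply: (IH [eta g with z |-> d]); last exact: none_supp_fresh.
  by apply/all_supp1D; split; [rewrite supp_fresh_subst1 | apply: all_supp_fresh].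
Qed.

End Support.

(** * Fair backward search and Hintikka sets *)

Section Saturation.

Variable ar : nat -> nat.

Definition occurs (S : cedent ar * cedent ar) (left : bool) (l : lformula ar) : Prop :=
  l \in (if left then S.1 else S.2).

(* One backward rule application to the signed labelled formula [(left, l)]
   leaves in [o] the active formulas of an underivable premise.  [Y] and [y] are
   the label and the variable chosen in (->L), (All L) and (IEx R). *)
Definition expanded (o : bool -> lformula ar -> Prop) (left : bool)
    (l : lformula ar) (e : label * nat) : Prop :=
  let: (X, phi) := l in let: (Y, y) := e in
  match phi, left with
  | Atom P xs, true => o true (X, Atom xs)
  | Atom P xs, false => exists2 k, k \in val X & o false (label1 k, Atom xs)
  | Bot, true => False
  | Bot, false => True
  | Imp a b, true => sublabel Y X -> o false (Y, a) \/ o true (Y, b)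
  | Imp a b, false => exists Z, [/\ sublabel Z X, o true (Z, a) & o false (Z, b)]
  | And a b, true => o true (X, a) /\ o true (X, b)
  | And a b, false => o false (X, a) \/ o false (X, b)
  | IOr a b, true => o true (X, a) \/ o true (X, b)
  | IOr a b, false => o false (X, a) /\ o false (X, b)
  | All x a, true => o true (X, subst1 a y x)
  | All x a, false => exists z, o false (X, subst1 a z x)
  | IEx x a, true => exists z, o true (X, subst1 a z x)
  | IEx x a, false => o false (X, subst1 a y x)
  end.

Lemma expandedW (o o' : bool -> lformula ar -> Prop) left l e :
  (forall c k, o c k -> o' c k) -> expanded o left l e -> expanded o' left l e.
Proof.
move=> oo'; case: l e left => X [P xs||a b|a b|a b|x a|x a] [Y y] [] //=.
- exact: oo'.
- by case=> k kX H; exists k; auto.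
- by move=> H YX; case: (H YX); auto.
- by case=> Z [ZX H1 H2]; exists Z; split; auto.
- by case; auto.
- by case; auto.
- by case; auto.
- by case; auto.
- exact: oo'.
- by case=> z H; exists z; auto.
- by case=> z H; exists z; auto.
- exact: oo'.
Qed.

Lemma exists_fresh (G D : cedent ar) :
  exists2 z, not_occurring z G & not_occurring z D.
Proof.
pose s := flatten [seq vars l.2 | l : lformula ar <- enum_mset G ++ enum_mset D].
have fr l : (l \in G) || (l \in D) -> avoid 0 s \notin vars l.2.
  move=> lGD; apply: contra (avoid_notin 0 s) => lv.
  by apply/flattenP; exists (vars l.2) => //; apply: map_f; rewrite mem_cat.
by exists (avoid 0 s) => l lG; apply: fr; rewrite lG ?orbT.
Qed.

(** A formula may disappear only when its demands are met for every choice [e] at once. A formula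
    with a separate demand for each choice, such as a left [All], has to stay for later tasks. *)
Definition persists (S S' : cedent ar * cedent ar) : Prop :=
  forall c l, occurs S c l -> occurs S' c l \/ forall e, expanded (occurs S') c l e.

Definition advances (S S' : cedent ar * cedent ar) left l e : Prop :=
  persists S S' /\ (occurs S left l -> expanded (occurs S') left l e).

(* The left alternative covers a principal formula consumed by its rule, the
   right one a principal formula repeated in the premise. *)
Lemma advances_left (G D G' D' : cedent ar) l e :
  {subset G <= G'} -> {subset D <= D'} ->
  (forall e', expanded (occurs (G', D')) true l e') \/
    l \in G' /\ expanded (occurs (G', D')) true l e ->
  advances (l +` G, D) (G', D') true l e.
Proof.
move=> GG' DD' H; split=> [[] k|_]; last by case: H => [|[]].
- rewrite /occurs in_mset1D => /predU1P[->|/GG']; last by left.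
  by case: H => [|[]]; [right | left].
- by move/DD'; left.
Qed.

Lemma advances_right (G D G' D' : cedent ar) l e :
  {subset G <= G'} -> {subset D <= D'} ->
  (forall e', expanded (occurs (G', D')) false l e') \/
    l \in D' /\ expanded (occurs (G', D')) false l e ->
  advances (G, l +` D) (G', D') false l e.
Proof.
move=> GG' DD' H; split=> [[] k|_]; last by case: H => [|[]].
- by move/GG'; left.
- rewrite /occurs in_mset1D => /predU1P[->|/DD']; last by left.
  by case: H => [|[]]; [right | left].
Qed.

(** Were all premises of the rule for [l] derivable, the conclusion would be too; classical logic
    therefore selects an underivable premise, also for the rules with one premise per world or per
    sublabel. *)
Lemma saturation_step (S : cedent ar * cedent ar) left l e :
  ~ derivable S.1 S.2 ->
  exists2 S', ~ derivable S'.1 S'.2 & advances S S' left l e.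
Proof.
move=> nd; case: (classic (occurs S left l)) => [|nocc]; last first.
  by exists S => //; split=> // c k; left.
case: S nd => G D; case: l e => X phi [Y y] /=; rewrite /occurs /=.
case: left => nd /msetB1K E; move: nd; rewrite -{}E.
  move: {G} (G `\ _) => G nd.
  have keep G' D' : ~ derivable G' D' -> {subset G <= G'} -> {subset D <= D'} ->
    (forall e', expanded (occurs (G', D')) true (X, phi) e') \/
      (X, phi) \in G' /\ expanded (occurs (G', D')) true (X, phi) (Y, y) ->
    exists2 S', ~ derivable S'.1 S'.2 & advances ((X, phi) +` G, D) S' true (X, phi) (Y, y).
    by move=> nd' GG' DD' H; exists (G', D') => //; apply: advances_left.
  case: phi nd keep => [P xs||a b|a b|a b|x a|x a] nd keep.
  (* No rule decomposes a left atom: its demand is its own occurrence, and the sequent is left as it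
     is. *)
  - apply: (keep _ _ nd) => [k kG|//|]; first by rewrite in_mset1D kG orbT.
    by left=> -[? ?]; rewrite /= /occurs /= in_mset1D eqxx.
  - by case: nd; apply: d_botL.
  (* If the scheduled [Y] is not a sublabel of [X], the demand is vacuous and the sequent is
     kept. *)
  - case: (boolP (sublabel Y X)) => [YX|/negP nYX]; last first.
      apply: (keep _ _ nd) => [k kG|//|]; first by rewrite in_mset1D kG orbT.
      by right; rewrite in_mset1D eqxx; split=> // /nYX.
    have /not_and_or[nd'|nd'] :
        ~ (derivable ((X, Imp a b) +` G) ((Y, a) +` D) /\
           derivable ((Y, b) +` ((X, Imp a b) +` G)) D).
    + by case=> d1 d2; apply/nd/(d_impL YX d1 d2).
    + apply: (keep _ _ nd') => [k kG|k kD|]; try by rewrite in_mset1D ?kG ?kD orbT.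
      by right; split=> [|_ /=]; [|left]; rewrite /occurs /= in_mset1D eqxx.
    + apply: (keep _ _ nd') => [k kG|//|]; first by rewrite !in_mset1D kG !orbT.
      right; split=> [|_ /=]; [|right]; by rewrite /occurs /= !in_mset1D eqxx ?orbT.
  - apply: (keep _ _ (fun d => nd (d_andL d))) => [k kG|//|].
      by rewrite !in_mset1D kG !orbT.
    by left=> -[? ?]; rewrite /= /occurs /= !in_mset1D !eqxx ?orbT.
  - have /not_and_or[nd'|nd'] :
        ~ (derivable ((X, a) +` G) D /\ derivable ((X, b) +` G) D).
    + by case=> d1 d2; apply/nd/(d_iorL d1 d2).
    + apply: (keep _ _ nd') => [k kG|//|]; first by rewrite !in_mset1D kG !orbT.
      by left=> -[? ?]; left; rewrite /occurs /= !in_mset1D !eqxx ?orbT.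
    + apply: (keep _ _ nd') => [k kG|//|]; first by rewrite !in_mset1D kG !orbT.
      by left=> -[? ?]; right; rewrite /occurs /= !in_mset1D !eqxx ?orbT.
  - apply: (keep _ _ (fun d => nd (d_allL (y := y) d))) => [k kG|//|].
      by rewrite !in_mset1D kG !orbT.
    by right; rewrite /= /occurs /= !in_mset1D !eqxx ?orbT.
  (* The eigenvariable must be fresh for the whole conclusion, principal formula included; the
     scheduled [y] has no influence here. *)
  - have [z zG zD] := exists_fresh ((X, IEx x a) +` G) D.
    apply: (keep _ _ (fun d => nd (d_iexL zG zD d))) => [k kG|//|].
      by rewrite !in_mset1D kG !orbT.
    by left=> -[? ?]; exists z; rewrite /occurs /= !in_mset1D !eqxx ?orbT.
move: {D} (D `\ _) => D nd.
have keep G' D' : ~ derivable G' D' -> {subset G <= G'} -> {subset D <= D'} ->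
  (forall e', expanded (occurs (G', D')) false (X, phi) e') \/
    (X, phi) \in D' /\ expanded (occurs (G', D')) false (X, phi) (Y, y) ->
  exists2 S', ~ derivable S'.1 S'.2 & advances (G, (X, phi) +` D) S' false (X, phi) (Y, y).
  by move=> nd' GG' DD' H; exists (G', D') => //; apply: advances_right.
case: phi nd keep => [P xs||a b|a b|a b|x a|x a] nd keep.
- have /not_all_ex_not[k] :
      ~ forall k, k \in val X -> derivable G ((label1 k, Atom xs) +` D).
    by move=> d; apply/nd/d_atR.
  case/(imply_to_and (is_true _)) => kX nd'.
  apply: (keep _ _ nd') => [//|j jD|]; first by rewrite !in_mset1D jD !orbT.
  by left=> -[? ?]; exists k => //; rewrite /occurs /= !in_mset1D !eqxx.
- by apply: (keep _ _ nd) => [//|k kD|]; [rewrite in_mset1D kD orbT | left=> -[]].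
- have /not_all_ex_not[Z] : ~ forall Z, sublabel Z X ->
      derivable ((Z, a) +` G) ((Z, b) +` D).
    by move=> d; apply/nd/d_impR.
  case/(imply_to_and (is_true _)) => ZX nd'.
  apply: (keep _ _ nd') => [k kG|k kD|]; try by rewrite in_mset1D ?kG ?kD orbT.
  by left=> -[? ?]; exists Z; split; rewrite // /occurs /= in_mset1D eqxx.
- have /not_and_or[nd'|nd'] :
      ~ (derivable G ((X, a) +` D) /\ derivable G ((X, b) +` D)).
  + by case=> d1 d2; apply/nd/(d_andR d1 d2).
  + apply: (keep _ _ nd') => [//|k kD|]; first by rewrite !in_mset1D kD !orbT.
    by left=> -[? ?]; left; rewrite /occurs /= !in_mset1D !eqxx ?orbT.
  + apply: (keep _ _ nd') => [//|k kD|]; first by rewrite !in_mset1D kD !orbT.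
    by left=> -[? ?]; right; rewrite /occurs /= !in_mset1D !eqxx ?orbT.
- apply: (keep _ _ (fun d => nd (d_iorR d))) => [//|k kD|].
    by rewrite !in_mset1D kD !orbT.
  by left=> -[? ?]; rewrite /= /occurs /= !in_mset1D !eqxx ?orbT.
- have [z zG zD] := exists_fresh G ((X, All x a) +` D).
  apply: (keep _ _ (fun d => nd (d_allR zG zD d))) => [//|k kD|].
    by rewrite !in_mset1D kD !orbT.
  by left=> -[? ?]; exists z; rewrite /occurs /= !in_mset1D !eqxx ?orbT.
- apply: (keep _ _ (fun d => nd (d_iexR (y := y) d))) => [//|k kD|].
    by rewrite !in_mset1D kD !orbT.
  by right; rewrite /= /occurs /= !in_mset1D !eqxx ?orbT.
Qed.

(** Stage [m] serves the task coded by the exponent of 2 in [m]. Multiplying the corresponding power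
    of 2 by arbitrarily large odd numbers makes each task recur beyond any bound. *)
Lemma fair_schedule (T : countType) :
  exists e : nat -> option T, forall t n, exists2 m, n <= m & e m = Some t.
Proof.
exists (fun m => choice.unpickle (logn 2 m)) => t n.
exists (2 ^ choice.pickle t * n.*2.+1).
  by rewrite (leq_trans _ (leq_pmull _ _)) ?expn_gt0 // -addnn ltnW // ltnS leq_addr.
rewrite lognM ?expn_gt0 // pfactorK // logn_coprime ?coprime2n ?oddS ?odd_double //.
by rewrite addn0 choice.pickleK.
Qed.

(* Dependent choice along a fair schedule of tasks; the limit [o] collects every
   formula that occurs at some stage, including those consumed later. *)
Lemma hintikka_exists (G D : cedent ar) : ~ derivable G D ->
  exists o : bool -> lformula ar -> Prop,
    [/\ forall c l, occurs (G, D) c l -> o c l,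
        forall c l e, o c l -> expanded o c l e
      & forall X P (xs : (ar P).-tuple nat) k, k \in val X ->
          o true (X, Atom xs) -> o false (label1 k, Atom xs) -> False].
Proof.
move=> nd0; pose task := ((bool * lformula ar) * (label * nat))%type.
have [sch schP] := fair_schedule task.
pose U := {S : cedent ar * cedent ar | ~ derivable S.1 S.2}.
have step_ex (S : U) n : exists S' : U,
    persists (sval S) (sval S') /\
    forall c l e, sch n = Some (c, l, e) -> occurs (sval S) c l ->
      expanded (occurs (sval S')) c l e.
  case: (sch n) => [[[c l] e]|]; last by exists S; split=> // c l; left.
  have [S' nd' [pers adv]] := saturation_step c l e (svalP S).
  by exists (exist _ S' nd'); split=> // _ _ _ [<- <- <-].
pose step S n := constructive_indefinite_description _ (step_ex S n).
pose fix St n : U := if n is m.+1 then sval (step (St m) m) else exist _ (G, D) nd0.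
have StP n : persists (sval (St n)) (sval (St n.+1)) /\
    forall c l e, sch n = Some (c, l, e) -> occurs (sval (St n)) c l ->
      expanded (occurs (sval (St n.+1))) c l e.
  exact: (svalP (step (St n) n)).
pose o c l := exists n, occurs (sval (St n)) c l.
have occ_o n c l : occurs (sval (St n)) c l -> o c l by exists n.
have stay c l n m : n <= m -> occurs (sval (St n)) c l ->
    occurs (sval (St m)) c l \/ forall e, expanded o c l e.
  move=> /subnKC <-; elim: (m - n)%N => [|d IHd] occn; first by rewrite addn0; left.
  rewrite addnS; case: (IHd occn) => [occd|]; last by right.
  have [/(_ _ _ occd)[occd1|H] _] := StP (n + d)%N; first by left.
  by right=> e; apply: expandedW (H e); apply: occ_o.
exists o; split=> [c l|c l e [n occn]|X P xs k kX [n occn] [m occm]].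
- exact: (occ_o 0).
(* The task recurs at some stage [m] past [n]; by then the formula has either been fully expanded or
   is still present and is expanded now. *)
- have [m nm schm] := schP (c, l, e) n.
  case: (stay c l n m nm occn) => // occm.
  have [_ /(_ _ _ _ schm occm)] := StP m.
  by apply: expandedW; apply: (occ_o m.+1).
(* Left atoms and right atoms with singleton labels never disappear, because their expansion yields
   the same signed formula again. Both therefore occur together at stage [maxn n m], which would
   then be an initial sequent. *)
- have atom c l i j : (forall S, (forall e, expanded (occurs S) c l e) -> occurs S c l) ->
      i <= j -> occurs (sval (St i)) c l -> occurs (sval (St j)) c l.
    move=> keep /subnKC <- occi; elim: (j - i)%N => [|d IHd]; first by rewrite addn0.
    by rewrite addnS; have [/(_ _ _ IHd)[occd|/keep occd] _] := StP (i + d)%N.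
  have occn' : occurs (sval (St (maxn n m))) true (X, Atom xs).
    by apply: (atom _ _ n); rewrite ?leq_maxl // => S /(_ (X, 0)).
  have occm' : occurs (sval (St (maxn n m))) false (label1 k, Atom xs).
    apply: (atom _ _ m); rewrite ?leq_maxr // => S /(_ (X, 0)) /= [j].
    by rewrite in_fset1 => /eqP ->.
  apply: (svalP (St (maxn n m))).
  rewrite -(msetB1K occn') -(msetB1K occm'); apply: d_id.
  by rewrite /sublabel /= fsub1set.
Qed.

(** * The countermodel and its truth lemma *)

Lemma completeness (G D : cedent ar) : ~ derivable G D ->
  exists V, all_supp V id G /\ none_supp V id D.
Proof.
move=> /hintikka_exists[o [subo expo ido]].
(* The least valuation supporting all left atoms. A right atom fails in it: its expansion gives a
   world [k] with the atom on the right at [label1 k], and [ido] then excludes every left label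
   containing [k]. *)
pose V k P (xs : (ar P).-tuple nat) := exists2 X : label, k \in val X & o true (X, Atom xs).
exists V.
have truth_atom P (xs : (ar P).-tuple nat) X :
    (o true (X, Atom xs) -> supp V id (Atom xs) X) /\
    (o false (X, Atom xs) -> ~ supp V id (Atom xs) X).
  rewrite /= (_ : map_tuple id xs = xs); last by apply: val_inj; rewrite /= map_id.
  split=> [HX k kX|/(expo _ _ (X, 0))[k kX Hk] /(_ k kX)[Y kY HY]]; first by exists X.
  exact: ido kY HY Hk.
have truth_bot X : (o true (X, Bot) -> supp V id Bot X) /\
    (o false (X, Bot) -> ~ supp V id Bot X).
  by split=> [/(expo _ _ (X, 0))|_].
(* Both signs are proved together, since a left implication puts its antecedent on the right. Where
   the choice in a task is irrelevant, [(X, 0)] serves as a dummy. *)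
have truth n phi X : fsize phi <= n ->
    (o true (X, phi) -> supp V id phi X) /\ (o false (X, phi) -> ~ supp V id phi X).
  elim: n phi X => [|n IHn] [P xs||a b|a b|a b|x a|x a] X //=;
    do 1?[by move=> _; apply: truth_atom | by move=> _; apply: truth_bot]; rewrite ltnS => sz.
  - have [sa sb] : fsize a <= n /\ fsize b <= n.
      by split; apply: leq_trans sz; rewrite ?leq_addr ?leq_addl.
    split=> [H Y YX Ha|/(expo _ _ (X, 0))[Y [YX Ha Hb]] /(_ Y YX)].
      by case: (expo _ _ (Y, 0) H YX) => [/(IHn a Y sa).2|/(IHn b Y sb).1].
    by move=> /(_ ((IHn a Y sa).1 Ha)); apply: (IHn b Y sb).2.
  - have [sa sb] : fsize a <= n /\ fsize b <= n.
      by split; apply: leq_trans sz; rewrite ?leq_addr ?leq_addl.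
    have [a1 a2] := IHn a X sa; have [b1 b2] := IHn b X sb.
    by split=> /(expo _ _ (X, 0)) /=; tauto.
  - have [sa sb] : fsize a <= n /\ fsize b <= n.
      by split; apply: leq_trans sz; rewrite ?leq_addr ?leq_addl.
    have [a1 a2] := IHn a X sa; have [b1 b2] := IHn b X sb.
    by split=> /(expo _ _ (X, 0)) /=; tauto.
  - have IH y := IHn (subst1 a y x) X (etrans (congr1 (leq^~ n) (fsize_subst _ a)) sz).
    split=> [H d|/(expo _ _ (X, 0))[z Hz] /(_ z)].
      (* Individuals are the variables themselves, assigned by [id], so the case of individual [d]
         is the instance at variable [d], demanded by the task [(X, d)]. *)
      by apply/(supp_subst1 V a id d x X)/(IH d).1/(expo _ _ (X, d) H).
    by move/(supp_subst1 V a id z x X); apply: (IH z).2.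
  - have IH y := IHn (subst1 a y x) X (etrans (congr1 (leq^~ n) (fsize_subst _ a)) sz).
    split=> [/(expo _ _ (X, 0))[z Hz]|H [d]].
      by exists z; apply/(supp_subst1 V a id z x X)/(IH z).1.
    by move/(supp_subst1 V a id d x X); apply/(IH d).2/(expo _ _ (X, d) H).
split=> -[X phi] lS; have [pos neg] := truth _ phi X (leqnn _).
- exact/pos/(subo true).
- exact/neg/(subo false).
Qed.

End Saturation.

(** * Admissibility of cut *)

Theorem theorem6 (ar : nat -> nat) (Gamma Delta Pi Sigma : {mset lformula ar})
    (X : label) (phi : formula ar) :
  derivable Gamma (Delta `+` [mset (X, phi) : lformula ar]) ->
  derivable ((X, phi) +` Pi) Sigma ->
  derivable (Gamma `+` Pi) (Delta `+` Sigma).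
Proof.
rewrite msetDC => dl dr; apply: NNPP => /completeness[V [HG HD]].
apply: (soundness dl (V := V) (g := id)) => [l lG|].
  by apply: HG; rewrite in_msetD lG.
apply/none_supp1D; split=> [Hphi|l lD]; last by apply: HD; rewrite in_msetD lD.
apply: (soundness dr (V := V) (g := id)) => [|l lS].
  by apply/all_supp1D; split=> // l lP; apply: HG; rewrite in_msetD lP orbT.
by apply: HD; rewrite in_msetD lS orbT.
Qed.
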